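(* (Correctness of FFJ$_{PL}$.) Let $pl=(t,CT,IT,RT,FM)$ be a well-typed FFJ$_{PL}$ product line, consisting of a well-typed term $t$, well-formed class, introduction and refinement tables $CT$, $IT$, $RT$, and a feature model $FM$. Let $fs$ be a feature selection that is valid in $FM$. Then the program $\mathit{derive}(pl,fs)$ is a well-typed FFJ program.
   Context: PART I: THE LANGUAGE FFJ. Conventions. An overlined symbol denotes a finite, possibly empty list; $\bullet$ is the empty list; judgments on lists are componentwise (lists of equal length). Lists of field declarations, method declarations and parameters contain no duplicate names. Class names: $A,\dots,E$ (including the distinguished $\mathsf{Object}$); field names $f,g,h$; method name $m$; variables $x$ (including $\mathsf{this}$); features: Greek letters, plus a symbol $\mathrm{Base}$ for the empty feature. Syntax. Class declarations $L ::= \mathsf{class}\ C\ \mathsf{extends}\ D\ \{\overline{C\ f};\ \overline M\}$; refinement declarations $R ::= \mathsf{refines\ class}\ C\ \{\overline{C\ f};\ \overline M\}$; methods $M ::= [\mathsf{overrides}]\ C\ m(\overline{C\ x})\{\mathsf{return}\ t;\}$ (the modifier $\mathsf{overrides}$ is optional); terms $t ::= x \mid t.f \mid t.m(\overline t) \mid \mathsf{new}\ C(\overline t) \mid (C)t$. Tables. Features are linearly ordered (composition order). The class table $CT$ is a partial map sending a qualified type $\Phi.C$ (feature $\Phi$, class name $C$) to a class or refinement declaration of $C$ (so a feature contains at most one declaration for $C$). $RT(C)$ is the list, in composition order, of all features $\Phi$ with $\Phi.C\in dom(CT)$. Sanity conditions: $CT(\Phi.C)$ is a declaration of $C$; $\mathsf{Object}$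 is not declared by $CT$; for every class name $C\neq\mathsf{Object}$ appearing in $CT$ there is some $\Phi$ with $\Phi.C\in dom(CT)$; the inheritance relation has no cycles. If $RT(C)=\Psi_1,\dots,\Psi_n$ then $last(C)=\Psi_n.C$; $last(\mathsf{Object})=\mathrm{Base}.\mathsf{Object}$. If $RT(C)=\Psi_1,\dots,\Psi_n,\Phi,\overline\Omega$ with $n\ge1$ then $pred(\Phi.C)=\Psi_n.C$; if $RT(C)=\Phi,\overline\Omega$ then $pred(\Phi.C)=\mathrm{Base}.\mathsf{Object}$. Subtyping $<:$ is the reflexive transitive closure of: $C<:D$ if $CT(\Phi.C)=\mathsf{class}\ C\ \mathsf{extends}\ D\{\dots\}$ for some $\Phi$. Lookup. $fields(\mathrm{Base}.\mathsf{Object})=\bullet$; if $CT(\Phi.C)$ is a class declaration with superclass $D$ and fields $\overline{C\ f}$, then $fields(\Phi.C)=fields(last(D)),\overline{C\ f}$; if it is a refinement with fields $\overline{C\ f}$, then $fields(\Phi.C)=fields(pred(\Phi.C)),\overline{C\ f}$. If $CT(\Phi.C)$ contains $[\mathsf{overrides}]\ B_0\ m(\overline{B\ x})\{\mathsf{return}\ t;\}$ then $mtype(m,\Phi.C)=\overline B\to B_0$; if it does not declare $m$, then $mtype(m,\Phi.C)$ is $mtype(m,last(D))$ for a class declaration with superclass $D$ and $mtype(m,pred(\Phi.C))$ for a refinement; $mtype$ is undefined at $\mathrm{Base}.\mathsf{Object}$. Predicates. $introduce(\Phi.C)$: there is no $\Psi\ne\Phi$ with $CT(\Psi.C)$ a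 class declaration. $introduce(f,\Phi.C)$: $f$ does not occur in $fields(\Phi.C)$. $introduce(m,\Phi.C)$: $mtype(m,\Phi.C)$ is undefined. $refine(\Phi.C)$: $RT(C)=\overline\Psi,\Phi,\overline\Omega$ and $CT(\Psi_1.C)$ is a class declaration. $override(m,\Phi.C,\overline C\to C_0)$: $mtype(m,\Phi.C)=\overline C\to C_0$. Term typing $\Gamma\vdash t:C$. T-Var: $\Gamma\vdash x:C$ if $x:C\in\Gamma$. T-Field: if $\Gamma\vdash t_0:C_0$ and $fields(last(C_0))=\overline{C\ f}$ then $\Gamma\vdash t_0.f_i:C_i$. T-Invk: if $\Gamma\vdash t_0:C_0$, $\Gamma\vdash\overline{t:C}$, $mtype(m,last(C_0))=\overline D\to C$, $\overline{C<:D}$ then $\Gamma\vdash t_0.m(\overline t):C$. T-New: if $\Gamma\vdash\overline{t:C}$, $fields(last(C))=\overline{D\ f}$, $\overline{C<:D}$ then $\Gamma\vdash\mathsf{new}\ C(\overline t):C$. Casts: if $\Gamma\vdash t_0:D$ then $\Gamma\vdash(C)t_0:C$, by T-UCast if $D<:C$, by T-DCast if $C<:D$ and $C\ne D$, and by T-SCast (with a ''stupid warning'') if neither $C<:D$ nor $D<:C$. Well-formedness. A method $[\mathsf{overrides}]\ B_0\ m(\overline{B\ x})\{\mathsf{return}\ t_0;\}$ is OK in $\Phi.C$ if $\overline{x:B},\mathsf{this}:C\vdash t_0:E_0$ with $E_0<:B_0$ and, writing $Q=last(D)$ if $CT(\Phi.C)$ is a class declaration extending $D$ and $Q=pred(\Phi.C)$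 if it is a refinement: $introduce(m,Q)$ if $\mathsf{overrides}$ is absent, $override(m,Q,\overline B\to B_0)$ if present. $\mathsf{class}\ C\ \mathsf{extends}\ D\{\overline{C\ f};\overline M\}$ is OK in $\Phi$ if $introduce(f,last(D))$ for all $f\in\overline f$, $introduce(\Phi.C)$, and all $\overline M$ are OK in $\Phi.C$. $\mathsf{refines\ class}\ C\{\overline{C\ f};\overline M\}$ is OK in $\Phi$ if $introduce(f,pred(\Phi.C))$ for all $f\in\overline f$, $refine(\Phi.C)$, and all $\overline M$ are OK in $\Phi.C$. An FFJ program (a term, $CT$, $RT$) is well-typed if the term is well-typed (in the empty typing context), every declaration $CT(\Phi.C)$ is OK in $\Phi$, and the tables satisfy the sanity conditions. PART II: PRODUCT LINES (FFJ$_{PL}$). Syntax. Class declarations $L ::= \mathsf{class}\ C\ \mathsf{extends}\ D\ \{\overline{C\ f};\ \overline M\}$, refinement declarations $R ::= \mathsf{refines\ class}\ C\ \{\overline{C\ f};\ \overline M\}$, methods $M ::= [\mathsf{overrides}]\ C\ m(\overline{C\ x})\{\mathsf{return}\ t;\}$ and terms $t ::= x \mid t.f \mid t.m(\overline t) \mid \mathsf{new}\ C(\overline t) \mid (C)t$, exactly as in FFJ. Tables. The tables now cover all features of the product line together, ordered by the feature model: $CT$ is a partial map sending a qualified type $\Phi.C$ ($\Phi$ any feature of the product line) to a class or refinement declaration of $C$, and $RT(C)$ is the list, in feature order, of all features $\Phi$ of the product line with $\Phi.C\in dom(CT)$. If $RT(C)=\Psi_1,\dots,\Psi_n$ then $last(C)=\Psi_n.C$;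 $last(\mathsf{Object})=\mathrm{Base}.\mathsf{Object}$. If $RT(C)=\Psi_1,\dots,\Psi_n,\Phi,\overline\Omega$ with $n\ge1$ then $pred(\Phi.C)=\Psi_n.C$; if $RT(C)=\Phi,\overline\Omega$ then $pred(\Phi.C)=\mathrm{Base}.\mathsf{Object}$. Sanity conditions for $CT$: $CT(\Phi.C)$ is a declaration of $C$; $\mathsf{Object}$ is not declared by $CT$; for every class name $C\neq\mathsf{Object}$ appearing in $CT$ there is some $\Phi$ with $\Phi.C\in dom(CT)$; but, differently from FFJ, a class (or field or method) may have several declarations as long as they are in mutually exclusive features, and the inheritance relation may have cycles, but not among classes reachable together from a given feature (i.e. not within one valid selection). The introduction table: $IT(C)$ is the list (in feature order) of features $\Psi$ such that $CT(\Psi.C)$ is a class declaration; $IT(C.f)$, $IT(C.m)$ list the features introducing field $f$, respectively method $m$, in class $C$ (or its refinements). Feature model. $FM$ determines the feature order and which feature selections (sets of features) are valid; it is otherwise arbitrary. A context $\overline\Omega$ is a finite list of features; below ''variant of $\overline\Omega$'' means a valid selection containing all of $\overline\Omega$ ($\mathrm{Base}$ counts as contained in every selection). $never(\overline\Omega,\Phi)$: no variant of $\overline\Omega$ contains $\Phi$. $sometimes(\overline\Omega,\Phi)$: some variant of $\overline\Omega$ contains $\Phi$. $always(\overline\Omega,\Phi)$ is a list: $\Phi$ if every variant of $\overline\Omega$ contains $\Phi$; otherwise $\Phi,\overline\Psi$ if $\Phi$ together with $\overline\Psi$ is a group of mutually exclusive features exactly one of which is in each variant of $\overline\Omega$; otherwise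 $\bullet$. $validref(\overline\Omega,C)$: every variant of $\overline\Omega$ contains a feature of $IT(C)$ (always true for $\mathsf{Object}$). $validref(\overline\Omega,C.f)$ (resp. $C.m$): in every variant of $\overline\Omega$, field $f$ (method $m$) is introduced by a selected feature in $C$ or in a direct or indirect superclass of $C$ in that variant (including refinements). On lists of elements, take the conjunction. $validref(\cdot)\dashv\overline\Psi$: same, where for class $C$ itself only declarations in features of $\overline\Psi$ are considered. Subtyping $C<:E\dashv\overline\Omega$, inductively: (i) $C<:C\dashv\overline\Omega$; (ii) for $C\neq\mathsf{Object}$: $C<:E\dashv\overline\Omega$ if $validref(\overline\Omega,C)$ and for all $\Psi\in IT(C)$ with $sometimes(\overline\Omega,\Psi)$: $CT(\Psi.C)=\mathsf{class}\ C\ \mathsf{extends}\ D\{\dots\}$ with $validref((\overline\Omega,\Psi),D)$ and $D<:E\dashv\overline\Omega,\Psi$. Field lookup $fields(\overline\Omega,\Phi.C)$ returns a list of lists of (possibly $@$-marked) field declarations, inner lists separated by $\circ$; $append$ adds given fields to every inner list. (FL-1) $fields(\overline\Omega,\Phi.\mathsf{Object})=\bullet$ (a single empty inner list). (FL-2) If $never(\overline\Omega,\Phi)$: $fields(\overline\Omega,pred(\Phi.C))$. Otherwise ($sometimes(\overline\Omega,\Phi)$), with $\overline{C\ f}$ the fields of $CT(\Phi.C)$ and $Q=last(D)$ if it is a class declaration extending $D$, $Q=pred(\Phi.C)$ if a refinement: (FL-3) if $always(\overline\Omega,\Phi)=\Phi$: $append(fields(\overline\Omega,Q),\overline{C\ f})$;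 (FL-4) if $always(\overline\Omega,\Phi)=\bullet$: $append(fields(\overline\Omega,Q),\overline{C\ f}@)$ (fields marked with $@$); (FL-5) if $always(\overline\Omega,\Phi)=\Psi_1,\dots,\Psi_n$ is a group: $fields((\overline\Omega,\Psi_1),\Phi.C)\circ\dots\circ fields((\overline\Omega,\Psi_n),\Phi.C)$. The marker $@$ only matters in T-New$_{PL}$ below. Method type lookup $mtype(\overline\Omega,m,\Phi.C)$ returns a list of signatures. (ML-1) $mtype(\overline\Omega,m,\mathrm{Base}.\mathsf{Object})=\bullet$. Otherwise it is the concatenation of $mtype(\overline\Omega,m,pred(\Phi.C))$; of $mtype(\overline\Omega,m,last(D))$ if $CT(\Phi.C)$ is a class declaration extending $D$; and of the signature $\overline B\to B_0$ if $CT(\Phi.C)$ declares $[\mathsf{overrides}]\ B_0\ m(\overline{B\ x})\{\dots\}$ and $sometimes(\overline\Omega,\Phi)$. Predicates. $introduce(\overline\Omega,\Phi.C)$: there is no $\Psi\neq\Phi$ with $CT(\Psi.C)$ a class declaration and $sometimes(\overline\Omega,\Psi)$. $introduce(\overline\Omega,f,\Phi.C)$: $f$ occurs in no inner list of $fields(\overline\Omega,\Phi.C)$. $introduce(\overline\Omega,m,\Phi.C)$: $mtype(\overline\Omega,m,\Phi.C)=\bullet$. $refine(\overline\Omega,\Phi.C)$: $RT(C)=\overline\Psi,\Phi,\overline\Pi$ and $validref(\overline\Omega,C)\dashv\overline\Psi$. $override(\overline\Omega,m,\Phi.C,\overline C\to C_0)$: $RT(C)=\overline\Psi,\Phi,\overline\Pi$,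 $validref(\overline\Omega,C.m)\dashv\overline\Psi,\Phi$, and every signature in $mtype(\overline\Omega,m,\Phi.C)$ equals $\overline C\to C_0$. Term typing $\Gamma\vdash t:\overline C\dashv\Phi$ ($\overline C$: list of possible types; $\Phi$: feature containing $t$). T-Var$_{PL}$: $\Gamma\vdash x:C\dashv\Phi$ if $x:C\in\Gamma$. T-Field$_{PL}$: if $\Gamma\vdash t_0:\overline E\dashv\Phi$, $validref(\Phi,E.f)$ for all $E\in\overline E$, and every inner list of every $fields(\Phi,last(E))$, $E\in\overline E$, contains a declaration of $f$, then $t_0.f$ has as list of types all the types of these declarations of $f$. T-Invk$_{PL}$: if $\Gamma\vdash t_0:\overline E\dashv\Phi$, each argument $t_j$ is typed with a list of types in $\Phi$, $validref(\Phi,E.m)$ for all $E\in\overline E$, and for every choice $\overline C$ of one possible type per argument and every signature $\overline D\to B$ in the lists $mtype(\Phi,m,last(E))$, $E\in\overline E$, one has $\overline{C<:D}\dashv\Phi$ (with equal lengths), then $t_0.m(\overline t)$ has as list of types all result types $B$ of these signatures. T-New$_{PL}$: if $validref(\Phi,C)$, each argument is typed with a list of types in $\Phi$, no field in $fields(\Phi,last(C))$ carries $@$, and for every inner list $\overline{D\ g}$ of $fields(\Phi,last(C))$ and every choice $\overline C$ of one possible type per argument $\overline{C<:D}\dashv\Phi$ (equal lengths), then $\Gamma\vdash\mathsf{new}\ C(\overline t):C\dashv\Phi$. Casts: if $validref(\Phi,C)$ and $\Gamma\vdash t_0:\overline E\dashv\Phi$ then $\Gamma\vdash(C)t_0:C\dashv\Phi$,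 by T-UDCast$_{PL}$ if for all $E\in\overline E$: $E<:C\dashv\Phi$ or $C<:E\dashv\Phi$; by T-SCast$_{PL}$ (with a ''stupid warning'') if for some $E\in\overline E$ neither holds. Well-formedness. $[\mathsf{overrides}]\ B_0\ m(\overline{B\ x})\{\mathsf{return}\ t_0;\}$ is OK in $\Phi.C$ if $\overline{x:B},\mathsf{this}:C\vdash t_0:\overline E\dashv\Phi$, $E<:B_0\dashv\Phi$ for all $E\in\overline E$, $validref(\Phi,\overline B)$, and with $Q=last(D)$ (class declaration extending $D$) or $Q=pred(\Phi.C)$ (refinement): $introduce(\Phi,m,Q)$ if $\mathsf{overrides}$ is absent, $override(\Phi,m,Q,\overline B\to B_0)$ if present. $\mathsf{class}\ C\ \mathsf{extends}\ D\{\overline{C\ f};\overline M\}$ is OK in $\Phi$ if $validref(\Phi,D)$, $validref(\Phi,\overline C)$ (field types), $introduce(\Phi,f,last(D))$ for all $f\in\overline f$, $introduce(\Phi,\Phi.C)$, and all $\overline M$ are OK in $\Phi.C$. $\mathsf{refines\ class}\ C\{\overline{C\ f};\overline M\}$ is OK in $\Phi$ if $validref(\Phi,\overline C)$, $introduce(\Phi,f,pred(\Phi.C))$ for all $f\in\overline f$, $refine(\Phi,\Phi.C)$, and all $\overline M$ are OK in $\Phi.C$. A product line $pl=(t,CT,IT,RT,FM)$ is well-typed if $t$ is well-typed by the FFJ$_{PL}$ term typing rules (empty typing context, in the empty feature $\mathrm{Base}$, which is present in every variant), every declaration $CT(\Phi.C)$ is OK in $\Phi$ by the FFJ$_{PL}$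 rules, and the tables satisfy their sanity conditions. Derivation. $\mathit{derive}(pl,fs)$ is the FFJ program with term $t$ whose class and refinement tables are obtained from $CT$ and $RT$ by deleting all declarations of features not in $fs$ (keeping the feature order).
   Formalization: In the well-formedness rule for methods of the product line, validref(Φ, ·) is also required of the result type B₀, not only of the parameter types; without it a derived program may mention an undeclared class, violating the FFJ sanity conditions. *)

(* Defs.v *)
From Stdlib Require List Relation_Operators.
From mathcomp Require Import all_boot.

Set Implicit Arguments.
Unset Strict Implicit.
Unset Printing Implicit Defensive.

Notation Forall2 := List.Forall2.
Notation clos_trans := Relation_Operators.clos_trans.
Notation clos_refl_trans := Relation_Operators.clos_refl_trans.

(** * Syntax, common to FFJ and its product lines *)

Definition cname := nat.
Definition fname := nat.
Definition mname := nat.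
Definition vname := nat.

Definition Object : cname := 0.
Definition this : vname := 0.

Inductive term :=
| TVar (x : vname)
| TField (t : term) (f : fname)
| TInvk (t : term) (m : mname) (ts : seq term)
| TNew (C : cname) (ts : seq term)
| TCast (C : cname) (t : term).

Definition fdecl := (cname * fname)%type.

Record method := Method {
  m_overrides : bool;
  m_ret : cname;
  m_name : mname;
  m_params : seq (cname * vname);
  m_body : term
}.

Definition signature := (seq cname * cname)%type.

Definition m_sig (M : method) : signature := (unzip1 (m_params M), m_ret M).

Inductive decl :=
| Class (C D : cname) (fds : seq fdecl) (ms : seq method)
| Refines (C : cname) (fds : seq fdecl) (ms : seq method).

Definition decl_name (d : decl) : cname :=
  match d with Class C _ _ _ => C | Refines C _ _ => C end.

Definition decl_fields (d : decl) : seq fdecl :=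
  match d with Class _ _ fds _ => fds | Refines _ fds _ => fds end.

Definition decl_methods (d : decl) : seq method :=
  match d with Class _ _ _ ms => ms | Refines _ _ ms => ms end.

Definition is_class (d : decl) : bool :=
  if d is Class _ _ _ _ then true else false.

Definition find_method (m : mname) (d : decl) : option method :=
  ohead [seq M <- decl_methods d | m_name M == m].

Fixpoint term_classes (t : term) : seq cname :=
  match t with
  | TVar _ => [::]
  | TField t0 _ => term_classes t0
  | TInvk t0 _ ts => term_classes t0 ++ flatten (map term_classes ts)
  | TNew C ts => C :: flatten (map term_classes ts)
  | TCast C t0 => C :: term_classes t0
  end.

Definition method_classes (M : method) : seq cname :=
  m_ret M :: unzip1 (m_params M) ++ term_classes (m_body M).

Definition decl_classes (d : decl) : seq cname :=
  decl_name d :: (if d is Class _ D _ _ then [:: D] else [::])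
  ++ unzip1 (decl_fields d) ++ flatten (map method_classes (decl_methods d)).

Definition decl_nodup (d : decl) : Prop :=
  [/\ uniq (unzip2 (decl_fields d)),
      uniq (map m_name (decl_methods d))
    & forall M, List.In M (decl_methods d) -> uniq (unzip2 (m_params M))].

Definition tenv := seq (vname * cname).

Definition method_env (M : method) (C : cname) : tenv :=
  rcons [seq (p.2, p.1) | p <- m_params M] (this, C).

(** * Tables

   Features are numbered in composition order, so that [enum 'I_n] lists all
   of them in that order.  [Base] is not a feature: it only occurs in the
   qualified type [Base.Object]. *)

Definition class_table (n : nat) := 'I_n -> cname -> option decl.

Inductive qtype (n : nat) :=
| BaseObject
| QType (Phi : 'I_n) (C : cname).
Arguments BaseObject {n}.

Section Tables.
Variables (n : nat) (CT : class_table n).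

Definition RT (C : cname) : seq 'I_n :=
  [seq Phi <- enum 'I_n | isSome (CT Phi C)].

Definition lastq (C : cname) : option (qtype n) :=
  if C == Object then Some BaseObject
  else if RT C is Psi :: Psis then Some (QType (last Psi Psis) C) else None.

(* Meaningful only when [Phi \in RT C]. *)
Definition predq (Phi : 'I_n) (C : cname) : qtype n :=
  if take (index Phi (RT C)) (RT C) is Psi :: Psis
  then QType (last Psi Psis) C else BaseObject.

(* Where the lookup in [Phi.C] continues: [last(D)] for a class declaration
   extending [D], [pred(Phi.C)] for a refinement. *)
Definition superq (Phi : 'I_n) (C : cname) : option (qtype n) :=
  match CT Phi C with
  | Some (Class _ D _ _) => lastq D
  | Some (Refines _ _ _) => Some (predq Phi C)
  | None => None
  end.

Definition class_decl (Phi : 'I_n) (C : cname) : bool :=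
  if CT Phi C is Some d then is_class d else false.

Definition extends_in (Phi : 'I_n) (C D : cname) : Prop :=
  exists fds ms, CT Phi C = Some (Class C D fds ms).

Definition extends (C D : cname) : Prop := exists Phi, extends_in Phi C D.

Definition acyclic : Prop := forall C, ~ clos_trans cname extends C C.

(* The sanity conditions shared by FFJ and product lines. *)
Definition table_sane : Prop :=
  [/\ forall Phi C d, CT Phi C = Some d -> decl_name d = C,
      forall Phi, CT Phi Object = None,
      forall Phi C d A, CT Phi C = Some d -> A \in decl_classes d ->
        A <> Object -> exists Psi, isSome (CT Psi A)
    & forall Phi C d, CT Phi C = Some d -> decl_nodup d].

End Tables.

(* [CT] without the declarations of the features outside [fs]. *)
Definition restrict n (CT : class_table n) (fs : {set 'I_n}) : class_table n :=
  fun Phi C => if Phi \in fs then CT Phi C else None.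

(** * FFJ *)

Module FFJ.

Record program := Program {
  nfeat : nat;
  main : term;
  ctable : class_table nfeat
}.
Arguments ctable : clear implicits.

Section Rules.
Variables (n : nat) (CT : class_table n).

Definition subtype : cname -> cname -> Prop :=
  clos_refl_trans cname (extends CT).

(* Lookup is recursive along the inheritance hierarchy, hence partial:
   [fields Q l] reads "[fields(Q)] is defined and equal to [l]", and
   [mtype m Q s] reads "[mtype(m, Q)] is defined and equal to [s]". *)
Inductive fields : qtype n -> seq fdecl -> Prop :=
| F_Object : fields BaseObject [::]
| F_Decl Phi C d Q l :
    CT Phi C = Some d -> superq CT Phi C = Some Q -> fields Q l ->
    fields (QType Phi C) (l ++ decl_fields d).

Inductive mtype (m : mname) : qtype n -> signature -> Prop :=
| M_Here Phi C d M :
    CT Phi C = Some d -> find_method m d = Some M ->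
    mtype m (QType Phi C) (m_sig M)
| M_Up Phi C d Q s :
    CT Phi C = Some d -> find_method m d = None ->
    superq CT Phi C = Some Q -> mtype m Q s ->
    mtype m (QType Phi C) s.

Definition introduce_class (Phi : 'I_n) (C : cname) : Prop :=
  ~ exists Psi, Psi <> Phi /\ class_decl CT Psi C.

Definition introduce_field (f : fname) (Q : qtype n) : Prop :=
  exists2 l, fields Q l & f \notin unzip2 l.

Definition introduce_method (m : mname) (Q : qtype n) : Prop :=
  ~ exists s, mtype m Q s.

Definition refine (Phi : 'I_n) (C : cname) : Prop :=
  exists Psi1 Psis Omegas,
    RT CT C = (Psi1 :: Psis) ++ Phi :: Omegas /\ class_decl CT Psi1 C.

Definition override (m : mname) (Q : qtype n) (s : signature) : Prop :=
  mtype m Q s.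

Inductive typed (G : tenv) : term -> cname -> Prop :=
| T_Var x C : (x, C) \in G -> typed G (TVar x) C
| T_Field t0 C0 Q l C f :
    typed G t0 C0 -> lastq CT C0 = Some Q -> fields Q l -> (C, f) \in l ->
    typed G (TField t0 f) C
| T_Invk t0 C0 m ts Cs Q Ds C :
    typed G t0 C0 -> Forall2 (typed G) ts Cs ->
    lastq CT C0 = Some Q -> mtype m Q (Ds, C) -> Forall2 subtype Cs Ds ->
    typed G (TInvk t0 m ts) C
| T_New C ts Cs Q l :
    Forall2 (typed G) ts Cs -> lastq CT C = Some Q -> fields Q l ->
    Forall2 subtype Cs (unzip1 l) ->
    typed G (TNew C ts) C
| T_UCast C t0 D : typed G t0 D -> subtype D C -> typed G (TCast C t0) C
| T_DCast C t0 D :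
    typed G t0 D -> subtype C D -> C <> D -> typed G (TCast C t0) C
| T_SCast C t0 D :
    typed G t0 D -> ~ subtype C D -> ~ subtype D C -> typed G (TCast C t0) C.

Definition method_ok (Phi : 'I_n) (C : cname) (M : method) : Prop :=
  (exists2 E0, typed (method_env M C) (m_body M) E0 & subtype E0 (m_ret M))
  /\ exists2 Q, superq CT Phi C = Some Q &
       if m_overrides M then override (m_name M) Q (m_sig M)
       else introduce_method (m_name M) Q.

Definition decl_ok (Phi : 'I_n) (d : decl) : Prop :=
  match d with
  | Class C D fds ms =>
      [/\ forall f, f \in unzip2 fds ->
            exists2 Q, lastq CT D = Some Q & introduce_field f Q,
          introduce_class Phi C
        & forall M, List.In M ms -> method_ok Phi C M]
  | Refines C fds ms =>
      [/\ forall f, f \in unzip2 fds -> introduce_field f (predq CT Phi C),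
          refine Phi C
        & forall M, List.In M ms -> method_ok Phi C M]
  end.

End Rules.

Definition well_typed (p : program) : Prop :=
  [/\ exists C, typed (ctable p) [::] (main p) C,
      forall Phi C d, ctable p Phi C = Some d -> decl_ok (ctable p) Phi d,
      table_sane (ctable p)
    & acyclic (ctable p)].

End FFJ.

(** * Product lines *)

Module PL.

(* The refinement table [RT] and the introduction tables below are functions of
   the class table and of the feature order.  The feature order is that of
   ['I_n], so what remains of the feature model is the set of valid
   selections. *)
Record product_line := ProductLine {
  nfeat : nat;
  main : term;
  ctable : class_table nfeat;
  valid : pred {set 'I_nfeat}
}.
Arguments ctable : clear implicits.
Arguments valid : clear implicits.

Section Rules.
Variables (n : nat) (CT : class_table n) (valid : pred {set 'I_n}).

(** ** Introduction tables *)

Definition IT_class (C : cname) : seq 'I_n :=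
  [seq Phi <- enum 'I_n | class_decl CT Phi C].

Definition IT_field (C : cname) (f : fname) : seq 'I_n :=
  [seq Phi <- enum 'I_n |
    if CT Phi C is Some d then f \in unzip2 (decl_fields d) else false].

(* An overriding declaration does not introduce the method. *)
Definition IT_method (C : cname) (m : mname) : seq 'I_n :=
  [seq Phi <- enum 'I_n |
    if CT Phi C is Some d then
      has (fun M => (m_name M == m) && ~~ m_overrides M) (decl_methods d)
    else false].

(** ** Feature model *)

(* [None] is the empty feature [Base], contained in every selection. *)
Definition ofeature := option 'I_n.
Definition context := seq ofeature.

Definition contains (fs : {set 'I_n}) (o : ofeature) : bool :=
  if o is Some Phi then Phi \in fs else true.

Definition variant (W : context) (fs : {set 'I_n}) : bool :=
  valid fs && all (contains fs) W.

Definition never (W : context) (Phi : 'I_n) : bool :=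
  [forall fs : {set 'I_n}, variant W fs ==> (Phi \notin fs)].

Definition sometimes (W : context) (Phi : 'I_n) : bool :=
  [exists fs : {set 'I_n}, variant W fs && (Phi \in fs)].

Definition in_all (W : context) (Phi : 'I_n) : bool :=
  [forall fs : {set 'I_n}, variant W fs ==> (Phi \in fs)].

Definition xor_group (W : context) (G : seq 'I_n) : Prop :=
  uniq G /\ forall fs, variant W fs -> count (mem fs) G = 1.

(* A feature may belong to several groups: [always W Phi l] reads "[l] is a
   possible value of [always(W, Phi)]". *)
Inductive always (W : context) (Phi : 'I_n) : seq 'I_n -> Prop :=
| A_All : in_all W Phi -> always W Phi [:: Phi]
| A_Group Psis :
    ~~ in_all W Phi -> xor_group W (Phi :: Psis) -> always W Phi (Phi :: Psis)
| A_None :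
    ~~ in_all W Phi -> ~ (exists Psis, xor_group W (Phi :: Psis)) ->
    always W Phi [::].

(** ** Valid references *)

Definition validref_class_in (W : context) (C : cname) (Psis : seq 'I_n)
    : Prop :=
  C = Object \/
  forall fs, variant W fs ->
    exists Phi, [/\ Phi \in fs, Phi \in IT_class C & Phi \in Psis].

Definition validref_class (W : context) (C : cname) : Prop :=
  C = Object \/
  forall fs, variant W fs -> exists2 Phi, Phi \in fs & Phi \in IT_class C.

Definition validref_classes (W : context) (Cs : seq cname) : Prop :=
  forall C, C \in Cs -> validref_class W C.

(* [introduced IT fs C]: in the variant [fs], a member with introduction table
   [IT] is introduced in [C] or in a direct or indirect superclass. *)
Inductive introduced (IT : cname -> seq 'I_n) (fs : {set 'I_n})
    : cname -> Prop :=
| I_Here C Phi : Phi \in fs -> Phi \in IT C -> introduced IT fs C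
| I_Super C D Phi :
    Phi \in fs -> extends_in CT Phi C D -> introduced IT fs D ->
    introduced IT fs C.

Definition introduced_in (IT : cname -> seq 'I_n) (fs : {set 'I_n})
    (C : cname) (Psis : seq 'I_n) : Prop :=
  (exists Phi, [/\ Phi \in fs, Phi \in Psis & Phi \in IT C]) \/
  (exists Phi D, [/\ Phi \in fs, Phi \in Psis, extends_in CT Phi C D
                   & introduced IT fs D]).

Definition validref_field (W : context) (C : cname) (f : fname) : Prop :=
  forall fs, variant W fs -> introduced (IT_field^~ f) fs C.

Definition validref_method (W : context) (C : cname) (m : mname) : Prop :=
  forall fs, variant W fs -> introduced (IT_method^~ m) fs C.

Definition validref_method_in (W : context) (C : cname) (m : mname)
    (Psis : seq 'I_n) : Prop :=
  forall fs, variant W fs -> introduced_in (IT_method^~ m) fs C Psis.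

(** ** Subtyping *)

(* [subtype W C E] is [C <: E] in context [W]. *)
Inductive subtype : context -> cname -> cname -> Prop :=
| S_Refl W C : subtype W C C
| S_Super W C E :
    C <> Object ->
    validref_class W C ->
    (forall Psi, Psi \in IT_class C -> sometimes W Psi ->
       exists D, extends_in CT Psi C D) ->
    (forall Psi D, Psi \in IT_class C -> sometimes W Psi ->
       extends_in CT Psi C D -> validref_class (rcons W (Some Psi)) D) ->
    (forall Psi D, Psi \in IT_class C -> sometimes W Psi ->
       extends_in CT Psi C D -> subtype (rcons W (Some Psi)) D E) ->
    subtype W C E.

(** ** Lookup *)

(* The boolean is the marker [@]. *)
Definition mfdecl := (fdecl * bool)%type.

Definition mark (b : bool) (fds : seq fdecl) : seq mfdecl :=
  [seq (fd, b) | fd <- fds].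

Definition append (ll : seq (seq mfdecl)) (l : seq mfdecl)
    : seq (seq mfdecl) :=
  [seq l0 ++ l | l0 <- ll].

Inductive fields : context -> qtype n -> seq (seq mfdecl) -> Prop :=
| FL_1 W : fields W BaseObject [:: [::]]
| FL_2 W Phi C ll :
    isSome (CT Phi C) -> never W Phi ->
    fields W (predq CT Phi C) ll ->
    fields W (QType Phi C) ll
| FL_3 W Phi C d Q ll :
    CT Phi C = Some d -> sometimes W Phi -> always W Phi [:: Phi] ->
    superq CT Phi C = Some Q -> fields W Q ll ->
    fields W (QType Phi C) (append ll (mark false (decl_fields d)))
| FL_4 W Phi C d Q ll :
    CT Phi C = Some d -> sometimes W Phi -> always W Phi [::] ->
    superq CT Phi C = Some Q -> fields W Q ll ->
    fields W (QType Phi C) (append ll (mark true (decl_fields d)))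
| FL_5 W Phi C Psi Psis lls :
    isSome (CT Phi C) -> sometimes W Phi ->
    always W Phi [:: Phi, Psi & Psis] ->
    Forall2 (fun X ll => fields (rcons W (Some X)) (QType Phi C) ll)
      [:: Phi, Psi & Psis] lls ->
    fields W (QType Phi C) (flatten lls).

(* [mtype W m Q s] reads "[s] occurs in the list [mtype(W, m, Q)]"; the order
   and multiplicity of the signatures are irrelevant to all rules.  Occurrence
   is defined inductively because the recursion, which follows every class
   declaration whether or not it can be selected, does not terminate when
   mutually exclusive features form an inheritance cycle. *)
Inductive mtype (W : context) (m : mname) : qtype n -> signature -> Prop :=
| ML_Pred Phi C s :
    isSome (CT Phi C) -> mtype W m (predq CT Phi C) s ->
    mtype W m (QType Phi C) s
| ML_Super Phi C D Q s :
    extends_in CT Phi C D -> lastq CT D = Some Q -> mtype W m Q s ->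
    mtype W m (QType Phi C) s
| ML_Here Phi C d M :
    CT Phi C = Some d -> find_method m d = Some M -> sometimes W Phi ->
    mtype W m (QType Phi C) (m_sig M).

(** ** Predicates *)

Definition introduce_class (W : context) (Phi : 'I_n) (C : cname) : Prop :=
  ~ exists Psi, [/\ Psi <> Phi, class_decl CT Psi C & sometimes W Psi].

Definition introduce_field (W : context) (f : fname) (Q : qtype n) : Prop :=
  exists2 ll, fields W Q ll &
    forall l, l \in ll -> f \notin unzip2 (unzip1 l).

Definition introduce_method (W : context) (m : mname) (Q : qtype n) : Prop :=
  ~ exists s, mtype W m Q s.

Definition refine (W : context) (Phi : 'I_n) (C : cname) : Prop :=
  exists Psis Pis,
    RT CT C = Psis ++ Phi :: Pis /\ validref_class_in W C Psis.

(* Never holds at [Base.Object], since [RT(Object)] is empty. *)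
Definition override (W : context) (m : mname) (Q : qtype n) (s : signature)
    : Prop :=
  if Q is QType Phi C then
    exists Psis Pis,
      [/\ RT CT C = Psis ++ Phi :: Pis,
          validref_method_in W C m (rcons Psis Phi)
        & forall s', mtype W m Q s' -> s' = s]
  else False.

(** ** Term typing *)

(* [choice Cs Tss]: [Cs] picks one possible type for each argument. *)
Definition choice (Cs : seq cname) (Tss : seq (seq cname)) : Prop :=
  Forall2 (fun C (Ts : seq cname) => C \in Ts) Cs Tss.

(* In [T_Field], [lls] collects [fields(Phi, last(E))] for [E] in [Es]. *)
Inductive typed (G : tenv) (o : ofeature) : term -> seq cname -> Prop :=
| T_Var x C : (x, C) \in G -> typed G o (TVar x) [:: C]
| T_Field t0 Es f lls :
    typed G o t0 Es ->
    (forall E, E \in Es -> validref_field [:: o] E f) ->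
    Forall2 (fun E ll =>
      exists2 Q, lastq CT E = Some Q & fields [:: o] Q ll) Es lls ->
    (forall ll l, ll \in lls -> l \in ll -> f \in unzip2 (unzip1 l)) ->
    typed G o (TField t0 f)
      [seq fd.1.1 | fd <- flatten (flatten lls) & fd.1.2 == f]
| T_Invk t0 Es m ts Tss Bs :
    typed G o t0 Es ->
    Forall2 (typed G o) ts Tss ->
    (forall E, E \in Es -> validref_method [:: o] E m) ->
    (forall E, E \in Es -> exists2 Q, lastq CT E = Some Q &
       forall Ds B Cs, mtype [:: o] m Q (Ds, B) -> choice Cs Tss ->
         Forall2 (subtype [:: o]) Cs Ds) ->
    (forall B, B \in Bs <->
       exists E Q Ds, [/\ E \in Es, lastq CT E = Some Q
                        & mtype [:: o] m Q (Ds, B)]) ->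
    typed G o (TInvk t0 m ts) Bs
| T_New C ts Tss Q ll :
    validref_class [:: o] C ->
    Forall2 (typed G o) ts Tss ->
    lastq CT C = Some Q -> fields [:: o] Q ll ->
    (forall l fd, l \in ll -> fd \in l -> ~~ fd.2) ->
    (forall l Cs, l \in ll -> choice Cs Tss ->
       Forall2 (subtype [:: o]) Cs (unzip1 (unzip1 l))) ->
    typed G o (TNew C ts) [:: C]
| T_UDCast C t0 Es :
    validref_class [:: o] C -> typed G o t0 Es ->
    (forall E, E \in Es -> subtype [:: o] E C \/ subtype [:: o] C E) ->
    typed G o (TCast C t0) [:: C]
| T_SCast C t0 Es :
    validref_class [:: o] C -> typed G o t0 Es ->
    (exists E, [/\ E \in Es, ~ subtype [:: o] E C & ~ subtype [:: o] C E]) ->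
    typed G o (TCast C t0) [:: C].

(** ** Well-formedness *)

(* The result type must be a valid reference, like the parameter types.  This
   does not follow from the typing of the body: [S_Refl] has no premise, so
   [B m() { return this.m(); }] would be accepted although no class [B] exists
   in some variants, and these variants would violate the sanity conditions
   of FFJ. *)
Definition method_ok (Phi : 'I_n) (C : cname) (M : method) : Prop :=
  let W : context := [:: Some Phi] in
  [/\ exists2 Es, typed (method_env M C) (Some Phi) (m_body M) Es &
        forall E, E \in Es -> subtype W E (m_ret M),
      validref_classes W (m_ret M :: unzip1 (m_params M))
    & exists2 Q, superq CT Phi C = Some Q &
        if m_overrides M then override W (m_name M) Q (m_sig M)
        else introduce_method W (m_name M) Q].

Definition decl_ok (Phi : 'I_n) (d : decl) : Prop :=
  let W : context := [:: Some Phi] in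
  match d with
  | Class C D fds ms =>
      [/\ validref_class W D,
          validref_classes W (unzip1 fds),
          forall f, f \in unzip2 fds ->
            exists2 Q, lastq CT D = Some Q & introduce_field W f Q,
          introduce_class W Phi C
        & forall M, List.In M ms -> method_ok Phi C M]
  | Refines C fds ms =>
      [/\ validref_classes W (unzip1 fds),
          forall f, f \in unzip2 fds -> introduce_field W f (predq CT Phi C),
          refine W Phi C
        & forall M, List.In M ms -> method_ok Phi C M]
  end.

End Rules.

Definition well_typed (pl : product_line) : Prop :=
  [/\ exists Cs, typed (ctable pl) (valid pl) [::] None (main pl) Cs,
      forall Phi C d, ctable pl Phi C = Some d ->
        decl_ok (ctable pl) (valid pl) Phi d,
      table_sane (ctable pl)
    & forall fs, valid pl fs -> acyclic (restrict (ctable pl) fs)].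

(* The refinement table of the result is that of [pl] without the features
   outside [fs], as [RT] is computed from the class table. *)
Definition derive (pl : product_line) (fs : {set 'I_(nfeat pl)})
    : FFJ.program :=
  FFJ.Program (main pl) (restrict (ctable pl) fs).
Arguments derive : clear implicits.

End PL.

(* Main.v *)
Require Import Defs.
From mathcomp Require Import all_boot.
From mathcomp Require Import zify.
From Stdlib Require Import Classical.

(* Fix a valid selection [fs] and write [CT'] for the derived class table.
   Every lookup of the product line, made in a context of which [fs] is a
   variant, approximates the lookup in [CT'] that starts from the same position
   of the refinement chain: the product line starts at the last declaration
   below that position, FFJ at the last selected one.  Since the class
   declarations of [C] exclude each other and each selected refinement has a
   selected class declaration before it, the selected declarations of [C] are
   one class declaration followed by refinements.  A term with possible types
   [Es] in the product line therefore has some type of [Es] in the derived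
   program. *)

Set Implicit Arguments.
Unset Strict Implicit.
Unset Printing Implicit Defensive.

(** * Positions in the refinement chain of a class *)

Section Position.
Variables (n : nat) (CT : class_table n).
Hypothesis CT_Object : forall Phi, CT Phi Object = None.

Definition declared_before (C : cname) (k : nat) : seq 'I_n :=
  [seq Phi : 'I_n <- RT CT C | Phi < k].

(* [last(C)], [pred(Phi.C)] and [Phi.C] are the values at [k = n], [k = Phi]
   and [k = Phi.+1]; unlike these it makes sense in every restriction of the
   class table. *)
Definition qtype_before (C : cname) (k : nat) : qtype n :=
  if declared_before C k is Phi :: Phis then QType (last Phi Phis) C
  else BaseObject.

Lemma pairwise_RT C : pairwise (fun Phi Psi : 'I_n => Phi < Psi) (RT CT C).
Proof.
apply: pairwise_filter; rewrite -(pairwise_map val ltn) val_enum_ord.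
by rewrite -(sorted_pairwise ltn_trans) iota_ltn_sorted.
Qed.

Lemma mem_RT C Phi : (Phi \in RT CT C) = isSome (CT Phi C).
Proof. by rewrite mem_filter mem_enum andbT. Qed.

(** Trades the list for the greatest declared feature below [k], a form in which positions of a
    table and of its restriction can be compared. *)
Variant qtype_before_spec C k : qtype n -> Prop :=
| BeforeNone of (forall Psi : 'I_n, Psi < k -> CT Psi C = None) :
    qtype_before_spec C k BaseObject
| BeforeSome (Phi : 'I_n) of isSome (CT Phi C) & Phi < k
    & (forall Psi : 'I_n, isSome (CT Psi C) -> Psi < k -> Psi <= Phi) :
    qtype_before_spec C k (QType Phi C).

Lemma qtype_beforeP C k : qtype_before_spec C k (qtype_before C k).
Proof.
rewrite /qtype_before.
have mem Psi : (Psi \in declared_before C k) = (Psi < k) && isSome (CT Psi C).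
  by rewrite mem_filter mem_RT.
have: pairwise (fun Phi Psi : 'I_n => Phi < Psi) (declared_before C k).
  exact: pairwise_filter (pairwise_RT C).
case: (lastP (declared_before C k)) mem => [|s x] mem.
  move=> _; apply: BeforeNone => Psi ltk.
  by move: (mem Psi); rewrite ltk; case: (CT Psi C).
rewrite pairwise_rcons => /andP[/allP ltx _].
have -> : (if rcons s x is Phi :: Phis then QType (last Phi Phis) C
           else BaseObject) = QType x C.
  by case: s {mem ltx} => //= y s; rewrite last_rcons.
have /andP[ltk xC] : (x < k) && isSome (CT x C).
  by rewrite -mem mem_rcons mem_head.
apply: BeforeSome => // Psi PsiC Psik.
have: Psi \in rcons s x by rewrite mem Psik.
rewrite mem_rcons inE => /predU1P[->//|/ltx]; exact: ltnW.
Qed.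

Lemma qtype_before_eq C k (Phi : 'I_n) :
  isSome (CT Phi C) -> Phi < k ->
  (forall Psi : 'I_n, isSome (CT Psi C) -> Psi < k -> Psi <= Phi) ->
  qtype_before C k = QType Phi C.
Proof.
move=> PhiC ltk max; case: qtype_beforeP => [none|Psi PsiC Psik max'].
  by rewrite none in PhiC.
congr QType; apply/val_inj/eqP.
by rewrite eqn_leq max // max'.
Qed.

Lemma qtype_before_none C k :
  (forall Psi : 'I_n, Psi < k -> CT Psi C = None) ->
  qtype_before C k = BaseObject.
Proof. by move=> none; case: qtype_beforeP => // Phi PhiC /none eqN; rewrite eqN in PhiC. Qed.

Lemma qtype_before_Object k : qtype_before Object k = BaseObject.
Proof. exact: qtype_before_none. Qed.

(** Since [RT C] is strictly increasing, a prefix of it is cut out by an inequality. This turns the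
    splittings in [refine] and [override] into positions. *)
Lemma RT_split C Psis (Phi : 'I_n) Pis :
  RT CT C = Psis ++ Phi :: Pis ->
  (forall Psi, Psi \in Psis = (Psi < Phi) && isSome (CT Psi C)).
Proof.
move=> eqRT Psi.
have := pairwise_RT C; rewrite eqRT pairwise_cat allrel_consr /=.
case/andP=> /andP[/allP lt1 _] /andP[_ /andP[/allP gt2 _]].
rewrite -mem_RT eqRT mem_cat inE.
apply/idP/andP=> [in1|[ltPhi /or3P[//|/eqP eqPhi|/gt2 /=]]].
- by rewrite in1 lt1.
- by rewrite eqPhi ltnn in ltPhi.
- lia.
Qed.

Lemma predqE C (Phi : 'I_n) :
  isSome (CT Phi C) -> predq CT Phi C = qtype_before C Phi.
Proof.
rewrite -mem_RT => RTPhi; rewrite /predq /qtype_before.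
suff -> : take (index Phi (RT CT C)) (RT CT C) = declared_before C Phi by [].
rewrite /declared_before.
have := pairwise_RT C.
case/splitPr: RTPhi => s1 s2; rewrite pairwise_cat allrel_consr /=.
case/andP=> /andP[/allP lt1 _] /andP[_ /andP[/allP gt2 _]].
have notin1 : Phi \notin s1 by apply/negP => /lt1 /=; rewrite ltnn.
rewrite index_cat (negbTE notin1) /= eqxx addn0 take_size_cat //.
rewrite filter_cat /= ltnn.
rewrite (eq_in_filter (a2 := predT)) ?filter_predT; last by move=> x /lt1 /= ->.
rewrite (eq_in_filter (a2 := pred0) (s := s2)) ?filter_pred0 ?cats0 //.
by move=> x /gt2 /=; lia.
Qed.

(** The hypothesis excludes an undeclared class other than [Object], where [lastq] is [None] while
    [qtype_before] falls back to [BaseObject]. *)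
Lemma lastqE C : C = Object \/ (exists Phi, isSome (CT Phi C)) ->
  lastq CT C = Some (qtype_before C n).
Proof.
case: (eqVneq C Object) => [-> _|CO].
  by rewrite /lastq eqxx qtype_before_Object.
case=> [/eqP|[Phi]]; first by rewrite (negbTE CO).
rewrite -mem_RT /lastq (negbTE CO) /qtype_before /declared_before.
rewrite (eq_filter (a2 := predT)) ?filter_predT; last by move=> x /=; rewrite ltn_ord.
by case: (RT CT C).
Qed.

Lemma lastq_inv C Q : lastq CT C = Some Q ->
  Q = qtype_before C n /\ (C = Object \/ exists Phi, isSome (CT Phi C)).
Proof.
move=> lastC.
have ex : C = Object \/ exists Phi, isSome (CT Phi C).
  move: lastC; rewrite /lastq; case: eqVneq => [|_]; first by left.
  case eqRT: (RT CT C) => [//|Phi s] _; right; exists Phi.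
  by rewrite -mem_RT eqRT mem_head.
by split=> //; move: lastC; rewrite lastqE // => -[].
Qed.

End Position.

(** * Selected declarations of a class *)

Section Derive.
Variables (n : nat) (CT : class_table n) (valid : pred {set 'I_n}).
Variable fs : {set 'I_n}.
Hypothesis valid_fs : valid fs.
Hypothesis decls_ok :
  forall Phi C d, CT Phi C = Some d -> PL.decl_ok CT valid Phi d.
Hypothesis CT_sane : table_sane CT.

Local Notation CT' := (restrict CT fs).

Lemma CT_Object Phi : CT Phi Object = None.
Proof. by case: CT_sane. Qed.

Lemma restrict_Object Phi : CT' Phi Object = None.
Proof. by rewrite /restrict CT_Object if_same. Qed.

Lemma declE Phi C d : CT Phi C = Some d -> decl_name d = C.
Proof. by case: CT_sane => name_ok _ _ _; apply: name_ok. Qed.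

Lemma restrict_some Phi C d :
  CT' Phi C = Some d <-> Phi \in fs /\ CT Phi C = Some d.
Proof. by rewrite /restrict; case: ifP => _; split=> [|[]]. Qed.

Lemma restrict_isSome Phi C :
  isSome (CT' Phi C) = (Phi \in fs) && isSome (CT Phi C).
Proof. by rewrite /restrict; case: ifP. Qed.

Lemma class_decl_extends Phi C :
  class_decl CT Phi C -> exists D, extends_in CT Phi C D.
Proof.
rewrite /class_decl; case eqC: (CT Phi C) => [[A D fds ms|//]|//] _.
by have /= eqA := declE eqC; subst A; exists D, fds, ms.
Qed.

Lemma mem_IT_class C Phi : (Phi \in PL.IT_class CT C) = class_decl CT Phi C.
Proof. by rewrite mem_filter mem_enum andbT. Qed.

Lemma class_decl_isSome Phi C : class_decl CT Phi C -> isSome (CT Phi C).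
Proof. by rewrite /class_decl; case: (CT Phi C). Qed.

Lemma extends_in_class Phi C D : extends_in CT Phi C D -> class_decl CT Phi C.
Proof. by case=> fds [ms]; rewrite /class_decl => ->. Qed.

Lemma variant_some W Phi :
  PL.variant valid (rcons W (Some Phi)) fs = PL.variant valid W fs && (Phi \in fs).
Proof. by rewrite /PL.variant all_rcons /= [X in _ && X]andbC andbA. Qed.

Lemma variant1 gs Phi :
  valid gs -> Phi \in gs -> PL.variant valid [:: Some Phi] gs.
Proof. by rewrite /PL.variant /= => -> ->. Qed.

Lemma sometimes_fs W Phi :
  PL.variant valid W fs -> Phi \in fs -> PL.sometimes valid W Phi.
Proof. by move=> vfs Phifs; apply/existsP; exists fs; rewrite vfs. Qed.

(** The selection [gs] itself witnesses [sometimes] for [Psi] in the context [Phi], against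
    [introduce_class] at [Phi]. It is arbitrary because groups and valid references quantify over
    all variants. *)
Lemma class_unique gs C Phi Psi :
  valid gs -> Phi \in gs -> Psi \in gs ->
  class_decl CT Phi C -> class_decl CT Psi C -> Phi = Psi.
Proof.
move=> vgs Phigs Psigs clPhi clPsi; apply/eqP/negPn/negP => neq.
have [D [fds [ms eqC]]] := class_decl_extends clPhi.
have [_ _ _ uniqC _] := decls_ok eqC.
apply: uniqC; exists Psi; split=> //.
  by move=> eqPsi; rewrite eqPsi eqxx in neq.
apply/existsP; exists gs.
by rewrite /PL.variant vgs /= Phigs Psigs.
Qed.

Lemma class_before_refinement gs Phi C :
  valid gs -> Phi \in gs -> isSome (CT Phi C) -> ~~ class_decl CT Phi C ->
  exists Psi : 'I_n, [/\ Psi \in gs, class_decl CT Psi C & Psi < Phi].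
Proof.
move=> vgs Phigs; rewrite /class_decl; case eqC: (CT Phi C) => [d|//] _.
case: d eqC => //= A fds ms eqC _; have /= eqA := declE eqC; subst A.
have [_ _ [Psis [Pis [eqRT ref]]] _] := decls_ok eqC.
case: ref => [CO|ref]; first by rewrite CO CT_Object in eqC.
have [Psi [Psigs]] := ref gs (variant1 vgs Phigs).
rewrite mem_IT_class (RT_split eqRT) => clPsi /andP[ltPsi _].
by exists Psi.
Qed.

Lemma decl_class_ex gs Phi C : valid gs -> Phi \in gs -> isSome (CT Phi C) ->
  exists2 Psi, Psi \in gs & class_decl CT Psi C.
Proof.
move=> vgs Phigs PhiC; have [clPhi|refPhi] := boolP (class_decl CT Phi C).
  by exists Phi.
by have [Psi []] := class_before_refinement vgs Phigs PhiC refPhi; exists Psi.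
Qed.

(** Were the later declaration a class declaration, the earlier one would be, or would have before
    it, a second selected class declaration. *)
Lemma later_refines (Phi Psi : 'I_n) C :
  isSome (CT' Phi C) -> isSome (CT' Psi C) -> Phi < Psi ->
  exists fds ms, CT' Psi C = Some (Refines C fds ms).
Proof.
rewrite !restrict_isSome => /andP[Phifs PhiC] /andP[Psifs PsiC] lt.
have [clPsi|] := boolP (class_decl CT Psi C); last first.
  move: PsiC; rewrite /class_decl /restrict Psifs.
  case eqC: (CT Psi C) => [[//|A fds ms]|//] _ _.
  by have /= eqA := declE eqC; subst A; exists fds, ms.
have [clPhi|refPhi] := boolP (class_decl CT Phi C).
  by move: lt; rewrite (class_unique valid_fs Phifs Psifs clPhi clPsi) ltnn.
have [Psi0 [fs0 cl0 lt0]] := class_before_refinement valid_fs Phifs PhiC refPhi.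
by move: lt0; rewrite (class_unique valid_fs fs0 Psifs cl0 clPsi); lia.
Qed.

Lemma validref_class_fs W C :
  PL.validref_class CT valid W C -> PL.variant valid W fs -> C <> Object ->
  exists Phi, Phi \in fs /\ class_decl CT Phi C.
Proof.
case=> [//|ref] vfs _; have [Phi Phifs] := ref fs vfs.
by rewrite mem_IT_class; exists Phi.
Qed.

Lemma superq_restrict_class Phi C D :
  Phi \in fs -> extends_in CT Phi C D ->
  superq CT' Phi C = Some (qtype_before CT' D n).
Proof.
move=> Phifs [fds [ms eqC]].
rewrite /superq /restrict Phifs eqC -/(restrict CT fs) lastqE //.
  exact: restrict_Object.
have [refD _ _ _ _] := decls_ok eqC.
case: (eqVneq D Object) => [|/eqP DO]; first by left.
have [Psi [Psifs clPsi]] := validref_class_fs refD (variant1 valid_fs Phifs) DO.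
by right; exists Psi; rewrite restrict_isSome Psifs class_decl_isSome.
Qed.

Lemma superq_restrict_refines Phi C fds ms :
  CT' Phi C = Some (Refines C fds ms) ->
  superq CT' Phi C = Some (qtype_before CT' C Phi).
Proof. by move=> eqC; rewrite /superq eqC predqE // eqC. Qed.

Lemma lastq_restrict W C :
  PL.validref_class CT valid W C -> PL.variant valid W fs ->
  lastq CT' C = Some (qtype_before CT' C n).
Proof.
move=> refC vfs; apply: lastqE; first exact: restrict_Object.
case: (eqVneq C Object) => [|/eqP CO]; first by left.
have [Psi [Psifs clPsi]] := validref_class_fs refC vfs CO.
by right; exists Psi; rewrite restrict_isSome Psifs class_decl_isSome.
Qed.

(** * Subtyping *)

(** Follow, at each step, the branch of the class declaration selected by [fs]; the context grows by
    a feature of [fs], so [fs] remains a variant of it. *)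
Lemma subtype_sound W C E :
  PL.subtype CT valid W C E -> PL.variant valid W fs -> FFJ.subtype CT' C E.
Proof.
elim=> {W C E} [W C _|W C E CO refC ex _ _ IH vfs].
  exact: Relation_Operators.rt_refl.
have [Psi [Psifs clPsi]] := validref_class_fs refC vfs CO.
have ITPsi : Psi \in PL.IT_class CT C by rewrite mem_IT_class.
have smt := sometimes_fs vfs Psifs.
have [D extD] := ex _ ITPsi smt.
apply: Relation_Operators.rt_trans (D) _ _ _; last first.
  by apply: IH extD _ => //; rewrite variant_some vfs.
apply: Relation_Operators.rt_step; exists Psi.
by case: extD => fds [ms eqC]; exists fds, ms; rewrite /restrict Psifs.
Qed.

(** * Method lookup *)

(** [ML_Pred] applies at every declaration, selected or not, so signatures only accumulate along the
    chain. *)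
Lemma PL_mtype_later W m Phi C s (k : nat) :
  PL.mtype CT valid W m (QType Phi C) s -> isSome (CT Phi C) -> Phi < k ->
  PL.mtype CT valid W m (qtype_before CT C k) s.
Proof.
move=> mt PhiC; elim/ltn_ind: k => k IH ltk.
case: qtype_beforeP => [none|Psi PsiC Psik max]; first by rewrite none in PhiC.
have := max _ PhiC ltk; rewrite leq_eqVlt => /predU1P[/val_inj <-//|lt].
by apply: PL.ML_Pred => //; rewrite predqE //; apply: IH.
Qed.

(** A refinement between [Phi] and [k] may redeclare [m]; the lookup stays defined, but its
    signature is then taken from there. *)
Lemma mtype_later m Phi C s (k : nat) :
  FFJ.mtype CT' m (QType Phi C) s -> isSome (CT' Phi C) -> Phi < k ->
  exists s', FFJ.mtype CT' m (qtype_before CT' C k) s'.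
Proof.
move=> mt PhiC; elim/ltn_ind: k => k IH ltk.
case: qtype_beforeP => [none|Psi PsiC Psik max]; first by rewrite none in PhiC.
have := max _ PhiC ltk; rewrite leq_eqVlt => /predU1P[/val_inj <-|lt].
  by exists s.
have [fds [ms eqC]] := later_refines PhiC PsiC lt.
case fm: (find_method m (Refines C fds ms)) => [M|].
  by exists (m_sig M); apply: FFJ.M_Here eqC fm.
have [s' mt'] := IH Psi Psik lt.
by exists s'; apply: FFJ.M_Up fm (superq_restrict_refines eqC) mt'; apply: eqC.
Qed.

(** The product line may start at a later, unselected declaration, to which [PL_mtype_later] carries
    the signature. The position is quantified after the derivation because lookup moves on to [n] in
    the superclass or to [Phi] in the same class. *)
Lemma mtype_sound W m Q s :
  PL.variant valid W fs -> FFJ.mtype CT' m Q s ->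
  forall C k, Q = qtype_before CT' C k ->
  PL.mtype CT valid W m (qtype_before CT C k) s.
Proof.
move=> vfs; elim=> {Q s} [Phi A d M /restrict_some[Phifs eqA] fm
                        |Phi A d Q s eqA' fm eqQ _ IH] C k.
  case: qtype_beforeP => // Psi PsiC Psik _ [? ?]; subst Psi A.
  move: PsiC; rewrite restrict_isSome => /andP[_ PsiC].
  apply: PL_mtype_later PsiC Psik.
  by apply: PL.ML_Here fm _ => //; apply: sometimes_fs.
case: qtype_beforeP => // Psi PsiC Psik _ [? ?]; subst Psi A.
move: PsiC; rewrite restrict_isSome => /andP[Phifs PhiC].
apply: PL_mtype_later (PhiC) Psik.
have [_ eqC] := (restrict_some Phi C d).1 eqA'.
have := declE eqC; case: d eqA' eqC fm => [A D|A] fds ms eqC' eqC fm /= ?; subst A.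
- have extC : extends_in CT Phi C D by exists fds, ms.
  move: eqQ; rewrite (superq_restrict_class Phifs extC) => -[eqQ].
  apply: PL.ML_Super extC _ (IH D n (esym eqQ)).
  have [refD _ _ _ _] := decls_ok eqC.
  apply: lastqE; first exact: CT_Object.
  case: (eqVneq D Object) => [|/eqP DO]; first by left.
  have [Psi [_ clPsi]] := validref_class_fs refD (variant1 valid_fs Phifs) DO.
  by right; exists Psi; apply: class_decl_isSome.
- move: eqQ; rewrite (superq_restrict_refines eqC') => -[eqQ].
  by apply: PL.ML_Pred => //; rewrite predqE //; apply: IH.
Qed.

Lemma find_method_has m d : has (fun M => m_name M == m) (decl_methods d) ->
  exists M, find_method m d = Some M.
Proof.
rewrite has_count -size_filter /find_method.
by case: [seq M <- decl_methods d | m_name M == m] => // M; exists M.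
Qed.

Lemma mtype_introduced_here m Phi C :
  Phi \in PL.IT_method CT C m -> Phi \in fs ->
  isSome (CT' Phi C) /\ exists s, FFJ.mtype CT' m (QType Phi C) s.
Proof.
rewrite mem_filter; case eqC: (CT Phi C) => [d|//] /andP[hasm _] Phifs.
rewrite restrict_isSome Phifs eqC; split=> //.
have [|M fm] := @find_method_has m d.
  by apply: sub_has hasm => M /andP[].
by exists (m_sig M); apply: FFJ.M_Here fm; rewrite /restrict Phifs.
Qed.

Lemma mtype_introduced_super m Phi C D :
  Phi \in fs -> extends_in CT Phi C D ->
  (exists s, FFJ.mtype CT' m (qtype_before CT' D n) s) ->
  exists s, FFJ.mtype CT' m (QType Phi C) s.
Proof.
move=> Phifs extC [s mt].
have eqQ := superq_restrict_class Phifs extC.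
case: extC => fds [ms eqC].
have eqC' : CT' Phi C = Some (Class C D fds ms) by rewrite /restrict Phifs.
case fm: (find_method m (Class C D fds ms)) => [M|].
  by exists (m_sig M); apply: FFJ.M_Here eqC' fm.
by exists s; apply: FFJ.M_Up eqC' fm eqQ mt.
Qed.

Lemma extends_in_isSome Phi C D :
  Phi \in fs -> extends_in CT Phi C D -> isSome (CT' Phi C).
Proof. by move=> Phifs [fds [ms eqC]]; rewrite /restrict Phifs eqC. Qed.

Lemma mtype_introduced m C :
  PL.introduced CT ((PL.IT_method CT)^~ m) fs C ->
  exists s, FFJ.mtype CT' m (qtype_before CT' C n) s.
Proof.
elim=> {C} [C Phi Phifs ITPhi|C D Phi Phifs extC _ IH].
  have [PhiC [s mt]] := mtype_introduced_here ITPhi Phifs.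
  exact: mtype_later mt PhiC _.
have [s mt] := mtype_introduced_super Phifs extC IH.
exact: mtype_later mt (extends_in_isSome Phifs extC) _.
Qed.

(** The form needed for [override], where only declarations of [C] up to a given position count. *)
Lemma mtype_introduced_in m C (Psis : seq 'I_n) (k : nat) :
  PL.introduced_in CT ((PL.IT_method CT)^~ m) fs C Psis ->
  (forall Phi : 'I_n, Phi \in Psis -> Phi < k) ->
  exists s, FFJ.mtype CT' m (qtype_before CT' C k) s.
Proof.
move=> [[Phi [Phifs inPsis ITPhi]]|[Phi [D [Phifs inPsis extC intr]]]] ltk.
  have [PhiC [s mt]] := mtype_introduced_here ITPhi Phifs.
  exact: mtype_later mt PhiC (ltk _ inPsis).
have [s mt] := mtype_introduced_super Phifs extC (mtype_introduced intr).
exact: mtype_later mt (extends_in_isSome Phifs extC) (ltk _ inPsis).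
Qed.

(** A derivation of [introduced] begins with a selected declaration of [C], and a selected
    refinement comes with a selected class declaration. Member accesses thus have a defined [lastq]
    in the derived table. *)
Lemma validref_member IT W C :
  (forall A Phi, Phi \in IT A -> isSome (CT Phi A)) ->
  (forall gs, PL.variant valid W gs -> PL.introduced CT IT gs C) ->
  PL.validref_class CT valid W C.
Proof.
move=> ITdecl intr; right=> gs vgs; have /andP[valid_gs _] := vgs.
have [Phi Phigs PhiC] : exists2 Phi, Phi \in gs & isSome (CT Phi C).
  case: (intr gs vgs) => [A Phi Phigs /ITdecl PhiA|A D Phi Phigs extA _].
    by exists Phi.
  by exists Phi; rewrite ?(class_decl_isSome (extends_in_class extA)).
have [Psi Psigs clPsi] := decl_class_ex valid_gs Phigs PhiC.
by exists Psi; rewrite ?mem_IT_class.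
Qed.

Lemma validref_field_class W C f :
  PL.validref_field CT valid W C f -> PL.validref_class CT valid W C.
Proof.
by apply: validref_member => A Phi; rewrite mem_filter; case: (CT Phi A).
Qed.

Lemma validref_method_class W C m :
  PL.validref_method CT valid W C m -> PL.validref_class CT valid W C.
Proof.
by apply: validref_member => A Phi; rewrite mem_filter; case: (CT Phi A).
Qed.

(** * Field lookup *)

Lemma Forall2_mem (T S : eqType) (R : T -> S -> Prop) s t x :
  Forall2 R s t -> x \in s -> exists2 y, y \in t & R x y.
Proof.
elim=> {s t} // a b s t Rab _ IH; rewrite inE => /predU1P[->|/IH[y y_in Rxy]].
  by exists b; rewrite ?mem_head.
by exists y; rewrite // inE y_in orbT.
Qed.

(** Provides the induction hypothesis for each feature of the group in [FL_5], where the recursive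
    premises sit under [Forall2]. *)
Lemma PL_fields_ind (P : PL.context n -> qtype n -> seq (seq PL.mfdecl) -> Prop) :
  (forall W, P W BaseObject [:: [::]]) ->
  (forall W Phi C ll, isSome (CT Phi C) -> PL.never valid W Phi ->
     P W (predq CT Phi C) ll -> P W (QType Phi C) ll) ->
  (forall W Phi C d Q ll, CT Phi C = Some d ->
     PL.always valid W Phi [:: Phi] -> superq CT Phi C = Some Q -> P W Q ll ->
     P W (QType Phi C) (PL.append ll (PL.mark false (decl_fields d)))) ->
  (forall W Phi C d Q ll, CT Phi C = Some d ->
     PL.always valid W Phi [::] -> superq CT Phi C = Some Q -> P W Q ll ->
     P W (QType Phi C) (PL.append ll (PL.mark true (decl_fields d)))) ->
  (forall W Phi C Psi Psis lls, isSome (CT Phi C) ->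
     PL.always valid W Phi [:: Phi, Psi & Psis] ->
     Forall2 (fun X ll => P (rcons W (Some X)) (QType Phi C) ll)
       [:: Phi, Psi & Psis] lls ->
     P W (QType Phi C) (flatten lls)) ->
  forall W Q ll, PL.fields CT valid W Q ll -> P W Q ll.
Proof.
move=> P1 P2 P3 P4 P5; fix IH 4 => W Q ll [] {W Q ll}.
- exact: P1.
- by move=> W Phi C ll PhiC nev /IH; apply: P2.
- by move=> W Phi C d Q ll eqC _ alw eqQ /IH; apply: P3 eqC alw eqQ.
- by move=> W Phi C d Q ll eqC _ alw eqQ /IH; apply: P4 eqC alw eqQ.
move=> W Phi C Psi Psis lls PhiC _ alw all; apply: P5 PhiC alw _.
elim: all => [|X ll Xs lls' /IH PX _ IHall]; first exact: List.Forall2_nil.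
exact: List.Forall2_cons.
Qed.

(** The value may also stem from a group with one member; its count being 1 then says the same. *)
Lemma always_single W Phi : PL.always valid W Phi [:: Phi] -> PL.in_all valid W Phi.
Proof.
move=> alw; inversion alw as [allPhi|Psis _ [_ one]|] => //.
by apply/forallP => gs; apply/implyP => /one /=; case: (Phi \in gs).
Qed.

(* [IT(C)] is a group of mutually exclusive features as soon as [C] is a valid
   reference, so that (FL-4) only ever marks refinements. *)
Lemma class_decl_always W Phi C :
  class_decl CT Phi C -> PL.validref_class CT valid W C ->
  ~ PL.always valid W Phi [::].
Proof.
move=> clPhi refC alw; inversion alw as [| |_ nogroup].
(* Taking [Phi] out brings [IT_class C], up to permutation, into the shape [Phi :: Psis] of a
   group. *)
case: nogroup; exists (rem Phi (PL.IT_class CT C)).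
have uniqIT : uniq (PL.IT_class CT C) by rewrite filter_uniq // enum_uniq.
have ITPhi : Phi \in PL.IT_class CT C by rewrite mem_IT_class.
have permIT := perm_to_rem ITPhi.
split=> [|gs vgs]; first by rewrite -(perm_uniq permIT).
rewrite -(permP permIT).
case: refC => [CO|/(_ gs vgs)[Psi Psigs ITPsi]].
  by have := class_decl_isSome clPhi; rewrite CO CT_Object.
rewrite (@eq_in_count _ _ (pred1 Psi)) => [|X ITX /=].
  by rewrite count_uniq_mem // ITPsi.
apply/idP/eqP => [Xgs|-> //]; have /andP[vgs' _] := vgs.
by move: ITX ITPsi; rewrite !mem_IT_class; apply: class_unique Xgs Psigs.
Qed.

Lemma validref_class_weaken W W' C :
  (forall gs, PL.variant valid W' gs -> PL.variant valid W gs) ->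
  PL.validref_class CT valid W C -> PL.validref_class CT valid W' C.
Proof.
move=> sub [CO|ref]; first by left.
by right=> gs /sub; apply: ref.
Qed.

(** No declaration lies strictly between [Phi] and [k], and one at [Phi] is dropped by the
    selection. *)
Lemma qtype_before_skip (Phi : 'I_n) C k :
  Phi \notin fs -> Phi < k ->
  (forall Psi : 'I_n, isSome (CT Psi C) -> Psi < k -> Psi <= Phi) ->
  qtype_before CT' C k = qtype_before CT' C Phi.
Proof.
move=> notfs ltk max.
have before Psi : isSome (CT' Psi C) -> Psi < k -> Psi < Phi.
  rewrite restrict_isSome => /andP[Psifs PsiC] Psik.
  rewrite ltn_neqAle max // andbT; apply: contraNneq notfs => /val_inj <-.
  exact: Psifs.
case: (qtype_beforeP CT' C Phi) => [none|Psi PsiC PsiPhi max'].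
  apply: qtype_before_none => Psi Psik.
  case eqC: (CT' Psi C) => [d|//].
  by rewrite -eqC none // before // eqC.
apply: qtype_before_eq => // [|Psi' Psi'C Psi'k]; first exact: ltn_trans ltk.
by apply: max' => //; apply: before.
Qed.

(* [l] is the expected value of the field lookup at [Q] in the variant [fs],
   except that the fields marked with [@] may be missing. *)
Definition lookup_agrees (ll : seq (seq PL.mfdecl)) (Q : qtype n) : Prop :=
  exists l l', [/\ l \in ll, FFJ.fields CT' Q l', {subset l' <= unzip1 l}
    & (forall fd, fd \in l -> ~~ fd.2) -> l' = unzip1 l].

Lemma unzip1_mark b fds : unzip1 (PL.mark b fds) = fds.
Proof. by rewrite /unzip1 /PL.mark -map_comp map_id. Qed.

Lemma lookup_agrees_append b Phi C d Q ll :
  CT' Phi C = Some d -> superq CT' Phi C = Some Q -> lookup_agrees ll Q ->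
  lookup_agrees (PL.append ll (PL.mark b (decl_fields d))) (QType Phi C).
Proof.
move=> eqC eqQ [l [l' [l_in fl' subl eql]]].
exists (l ++ PL.mark b (decl_fields d)), (l' ++ decl_fields d).
rewrite /unzip1 map_cat -!/unzip1 unzip1_mark; split.
- by apply/mapP; exists l.
- exact: FFJ.F_Decl eqC eqQ fl'.
- by move=> x; rewrite !mem_cat => /orP[/subl ->|->]; rewrite ?orbT.
- by move=> nomark; rewrite eql // => fd fdl; apply: nomark; rewrite mem_cat fdl.
Qed.

(** The case of an unselected refinement. The equality clause survives because a list without marks
    forces [fds] to be empty. *)
Lemma lookup_agrees_absent fds Q ll :
  lookup_agrees ll Q -> lookup_agrees (PL.append ll (PL.mark true fds)) Q.
Proof.
move=> [l [l' [l_in fl' subl eql]]].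
exists (l ++ PL.mark true fds), l'; rewrite /unzip1 map_cat -!/unzip1 unzip1_mark.
split=> //; first by apply/mapP; exists l.
  by move=> x /subl; rewrite mem_cat => ->.
case: fds => [|fd fds] nomark.
  by rewrite cats0 eql // => fd fdl; apply: nomark; rewrite mem_cat fdl.
by have := nomark (fd, true); rewrite mem_cat mem_head orbT => /(_ isT).
Qed.

(** The valid reference to [C] is carried along so that [class_decl_always] excludes [FL_4] at a
    class declaration: only fields of refinements can be missing. *)
Lemma fields_sound W Q ll :
  PL.fields CT valid W Q ll -> PL.variant valid W fs ->
  forall C k, Q = qtype_before CT C k -> PL.validref_class CT valid W C ->
  lookup_agrees ll (qtype_before CT' C k).
Proof.
elim/PL_fields_ind => {W Q ll}
  [W vfs C k|W Phi A ll _ nev IH vfs C k|W Phi A d Q ll eqA alw eqQ IH vfs C k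
  |W Phi A d Q ll eqA alw eqQ IH vfs C k|W Phi A Psi Psis lls _ alw IH vfs C k].
- case: qtype_beforeP => // none _ _; exists [::], [::].
  rewrite mem_head qtype_before_none; first by split=> //; apply: FFJ.F_Object.
  by move=> Phi /none; rewrite /restrict => ->; rewrite if_same.
- case: qtype_beforeP => // Psi PsiC ltk max [? ?] refC; subst Psi A.
  have notfs : Phi \notin fs by have /forallP/(_ fs) := nev; rewrite vfs.
  by rewrite (qtype_before_skip notfs ltk max); apply: IH => //; apply: predqE.
- case: qtype_beforeP => // Psi PsiC ltk max [? ?] refC; subst Psi A.
  have inW := always_single alw.
  have Phifs : Phi \in fs by have /forallP/(_ fs) := inW; rewrite vfs.
  have eqA' : CT' Phi C = Some d by rewrite /restrict Phifs.
  have -> : qtype_before CT' C k = QType Phi C.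
    apply: qtype_before_eq => // [|Psi]; first by rewrite eqA'.
    by rewrite restrict_isSome => /andP[_]; apply: max.
  have := declE eqA; case: d eqA eqA' eqQ => [A D|A] fds ms eqA eqA' eqQ /= ?; subst A.
    have extC : extends_in CT Phi C D by exists fds, ms.
    move: eqQ; rewrite /superq eqA => /(lastq_inv CT_Object)[eqQ _].
    apply: lookup_agrees_append eqA' (superq_restrict_class Phifs extC) _.
    (* As [Phi] is in every variant of [W], the reference to [D], valid in the context [Phi], is
       valid in [W]. *)
    apply: IH => //; have [refD _ _ _ _] := decls_ok eqA.
    apply: validref_class_weaken refD => gs vgs; have /andP[valid_gs _] := vgs.
    by apply: variant1 => //; have /forallP/(_ gs) := inW; rewrite vgs.
  move: eqQ; rewrite /superq eqA => -[eqQ].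
  apply: lookup_agrees_append (eqA') (superq_restrict_refines eqA') _.
  by apply: IH => //; rewrite -eqQ predqE.
- case: qtype_beforeP => // Psi PsiC ltk max [? ?] refC; subst Psi A.
  have := declE eqA; case: d eqA eqQ => [A D|A] fds ms eqA eqQ /= ?; subst A.
    have clPhi : class_decl CT Phi C by rewrite /class_decl eqA.
    by case: (class_decl_always clPhi refC alw).
  move: eqQ; rewrite /superq eqA => -[eqQ].
  have agr : lookup_agrees ll (qtype_before CT' C Phi).
    by apply: IH => //; rewrite -eqQ predqE.
  have [Phifs|notfs] := boolP (Phi \in fs); last first.
    by rewrite (qtype_before_skip notfs ltk max); apply: lookup_agrees_absent.
  have eqA' : CT' Phi C = Some (Refines C fds ms) by rewrite /restrict Phifs.
  have -> : qtype_before CT' C k = QType Phi C.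
    apply: qtype_before_eq => // [|Psi]; first by rewrite eqA'.
    by rewrite restrict_isSome => /andP[_]; apply: max.
  exact: lookup_agrees_append (eqA') (superq_restrict_refines eqA') agr.
- move=> eqQ refC.
  (* The inner list is taken from the branch of the group member that [fs] selects. *)
  have [X X_in Xfs] : exists2 X, X \in [:: Phi, Psi & Psis] & X \in fs.
    inversion alw as [|Psis' _ [_ one]|].
    by apply/hasP; rewrite has_count one.
  have [ll ll_in agr] := Forall2_mem IH X_in.
  have vfsX : PL.variant valid (rcons W (Some X)) fs by rewrite variant_some vfs.
  have refX : PL.validref_class CT valid (rcons W (Some X)) C.
    apply: validref_class_weaken refC => gs.
    by rewrite /PL.variant all_rcons => /and3P[-> _ ->].
  have [l [l' [l_in fl' subl eql]]] := agr vfsX C k eqQ refX.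
  by exists l, l'; split=> //; apply/flattenP; exists ll.
Qed.

Lemma fields_inv Phi C l :
  FFJ.fields CT' (QType Phi C) l ->
  exists d Q l0, [/\ CT' Phi C = Some d, superq CT' Phi C = Some Q,
    FFJ.fields CT' Q l0 & l = l0 ++ decl_fields d].
Proof. by move=> fl; inversion fl as [|? ? d Q l0]; exists d, Q, l0. Qed.

(** The selected declarations after [Phi] and below [k] are refinements, which only append fields to
    the lookup at their predecessor. *)
Lemma fields_later Phi C (k : nat) l :
  FFJ.fields CT' (qtype_before CT' C k) l -> isSome (CT' Phi C) -> Phi < k ->
  exists2 l0, FFJ.fields CT' (QType Phi C) l0 & {subset l0 <= l}.
Proof.
move=> fl PhiC; elim/ltn_ind: k l fl => k IH l.
case: qtype_beforeP => [none _ /none eqN|Psi PsiC Psik max fl ltk].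
  by rewrite eqN in PhiC.
have := max _ PhiC ltk; rewrite leq_eqVlt => /predU1P[/val_inj->|lt].
  by exists l.
have [fds [ms eqC]] := later_refines PhiC PsiC lt.
have [d [Q [l1 [_ eqQ fl1 ->]]]] := fields_inv fl.
move: eqQ; rewrite (superq_restrict_refines eqC) => -[eqQ].
rewrite -eqQ in fl1; have [l0 fl0 sub] := IH Psi Psik l1 fl1 lt.
by exists l0 => // x /sub; rewrite mem_cat => ->.
Qed.

(** Complements [fields_sound], which bounds the derived fields only from above: a marked field
    might be missing, but not one that is validly referenced. *)
Lemma fields_introduced f C l :
  PL.introduced CT ((PL.IT_field CT)^~ f) fs C ->
  FFJ.fields CT' (qtype_before CT' C n) l -> f \in unzip2 l.
Proof.
move=> intr; elim: intr l => {C} [C Phi Phifs ITPhi|C D Phi Phifs extC _ IH] l fl.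
  move: ITPhi; rewrite mem_filter; case eqC: (CT Phi C) => [d|//] /andP[f_in _].
  have eqC' : CT' Phi C = Some d by rewrite /restrict Phifs.
  have [||l0 fl0 sub] := fields_later (Phi := Phi) fl; rewrite ?eqC' //.
  have [d' [Q [l1 [eqd _ _ eql]]]] := fields_inv fl0.
  move: eqd; rewrite eqC' => -[eqd]; rewrite -{}eqd in eql.
  have [fd fd_in ->] := mapP f_in; apply/map_f/sub.
  by rewrite eql mem_cat fd_in orbT.
have PhiC := extends_in_isSome Phifs extC.
have [||l0 fl0 sub] := fields_later (Phi := Phi) fl; rewrite ?PhiC //.
have [d' [Q [l1 [_ eqQ fl1 eql]]]] := fields_inv fl0.
move: eqQ; rewrite (superq_restrict_class Phifs extC) => -[eqQ].
rewrite -eqQ in fl1; have [fd fd_in ->] := mapP (IH _ fl1).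
by apply/map_f/sub; rewrite eql mem_cat fd_in.
Qed.

(** * Term typing *)

(** Provides induction hypotheses for the arguments under [Forall2]; both cast rules share one
    case. *)
Lemma PL_typed_ind G o (P : term -> seq cname -> Prop) :
  (forall x C, (x, C) \in G -> P (TVar x) [:: C]) ->
  (forall t0 Es f lls, P t0 Es ->
     (forall E, E \in Es -> PL.validref_field CT valid [:: o] E f) ->
     Forall2 (fun E ll => exists2 Q, lastq CT E = Some Q &
       PL.fields CT valid [:: o] Q ll) Es lls ->
     P (TField t0 f)
       [seq fd.1.1 | fd <- flatten (flatten lls) & fd.1.2 == f]) ->
  (forall t0 Es m ts Tss Bs, P t0 Es -> Forall2 P ts Tss ->
     (forall E, E \in Es -> PL.validref_method CT valid [:: o] E m) ->
     (forall E, E \in Es -> exists2 Q, lastq CT E = Some Q &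
        forall Ds B Cs, PL.mtype CT valid [:: o] m Q (Ds, B) ->
          PL.choice Cs Tss -> Forall2 (PL.subtype CT valid [:: o]) Cs Ds) ->
     (forall B, B \in Bs <-> exists E Q Ds, [/\ E \in Es, lastq CT E = Some Q
        & PL.mtype CT valid [:: o] m Q (Ds, B)]) ->
     P (TInvk t0 m ts) Bs) ->
  (forall C ts Tss Q ll, PL.validref_class CT valid [:: o] C ->
     Forall2 P ts Tss -> lastq CT C = Some Q ->
     PL.fields CT valid [:: o] Q ll ->
     (forall l fd, l \in ll -> fd \in l -> ~~ fd.2) ->
     (forall l Cs, l \in ll -> PL.choice Cs Tss ->
        Forall2 (PL.subtype CT valid [:: o]) Cs (unzip1 (unzip1 l))) ->
     P (TNew C ts) [:: C]) ->
  (forall C t0 Es, PL.validref_class CT valid [:: o] C -> P t0 Es ->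
     P (TCast C t0) [:: C]) ->
  forall t Es, PL.typed CT valid G o t Es -> P t Es.
Proof.
move=> PVar PField PInvk PNew PCast; fix IH 3 => t Es.
case=> {t Es}.
- exact: PVar.
- by move=> t0 Es f lls /IH Pt0 refs lookups _; apply: PField Pt0 refs lookups.
- move=> t0 Es m ts Tss Bs /IH Pt0 args refs sigs eqBs.
  apply: PInvk Pt0 _ refs sigs eqBs.
  by elim: args => [|s Ts ts' Tss' /IH Ps _ IHts]; constructor.
- move=> C ts Tss Q ll refC args eqQ fll nomark subs.
  apply: PNew refC _ eqQ fll nomark subs.
  by elim: args => [|s Ts ts' Tss' /IH Ps _ IHts]; constructor.
- by move=> C t0 Es refC /IH Pt0 _; apply: PCast refC Pt0.
- by move=> C t0 Es refC /IH Pt0 _; apply: PCast refC Pt0.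
Qed.

(** The three FFJ cast rules cover all pairs of types once subtyping is decided classically; for
    [C = D], reflexivity makes it an upcast. *)
Lemma typed_cast G C t0 D :
  FFJ.typed CT' G t0 D -> FFJ.typed CT' G (TCast C t0) C.
Proof.
move=> ty; have [subDC|notDC] := classic (FFJ.subtype CT' D C).
  exact: FFJ.T_UCast ty subDC.
have [subCD|notCD] := classic (FFJ.subtype CT' C D).
  apply: FFJ.T_DCast ty subCD _ => eqCD; apply: notDC.
  by rewrite eqCD; apply: Relation_Operators.rt_refl.
exact: FFJ.T_SCast ty notCD notDC.
Qed.

Lemma Forall2_choice (T : Type) (R : T -> cname -> Prop) ts Tss :
  Forall2 (fun t (Ts : seq cname) => exists2 C, C \in Ts & R t C) ts Tss ->
  exists2 Cs, PL.choice Cs Tss & Forall2 R ts Cs.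
Proof.
elim=> [|t Ts ts' Tss' [C C_in RtC] _ [Cs chCs RCs]].
  by exists [::]; constructor.
by exists (C :: Cs); constructor.
Qed.

Lemma subtypes_sound W Cs Ds :
  PL.variant valid W fs -> Forall2 (PL.subtype CT valid W) Cs Ds ->
  Forall2 (FFJ.subtype CT') Cs Ds.
Proof.
by move=> vfs; apply: List.Forall2_impl => C D sub; apply: subtype_sound sub vfs.
Qed.

Lemma typed_sound G o t Es :
  PL.typed CT valid G o t Es -> PL.variant valid [:: o] fs ->
  exists2 C, C \in Es & FFJ.typed CT' G t C.
Proof.
move=> ty vfs; elim/PL_typed_ind: ty => {t Es}
  [x C xC|t0 Es f lls [E E_in tyE] reff lookups
  |t0 Es m ts Tss Bs [E E_in tyE] /Forall2_choice[Cs chCs tyCs] refm sigs BsE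
  |C ts Tss Q ll refC /Forall2_choice[Cs chCs tyCs] eqQ fll nomark subs
  |C t0 Es refC [E E_in tyE]].
- by exists C; [apply: mem_head|apply: FFJ.T_Var].
- have refE := validref_field_class (reff E E_in).
  have [ll ll_in [Q eqQ fll]] := Forall2_mem lookups E_in.
  have [eqQn _] := lastq_inv CT_Object eqQ.
  have [l [l' [l_in fl' subl _]]] := fields_sound fll vfs eqQn refE.
  have [[C g] fd_in /= eqg] := mapP (fields_introduced (reff E E_in fs vfs) fl').
  exists C; last first.
    by apply: FFJ.T_Field tyE (lastq_restrict refE vfs) fl' _; rewrite eqg.
  have [[[C' g'] b] fdb_in /= [eqC' eqg']] := mapP (subl _ fd_in).
  apply/mapP; exists (C', g', b) => //=.
  rewrite mem_filter /= eqg eqg' eqxx /=; apply/flattenP; exists l => //.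
  by apply/flattenP; exists ll.
- have refE := validref_method_class (refm E E_in).
  (* The valid reference makes the derived lookup defined; its signature is then among those of the
     product line, which were checked for every choice of argument types. *)
  have [[Ds B] mt'] := mtype_introduced (refm E E_in fs vfs).
  have [Q eqQ subs] := sigs E E_in.
  have [eqQn _] := lastq_inv CT_Object eqQ.
  have mt : PL.mtype CT valid [:: o] m Q (Ds, B).
    by rewrite eqQn; apply: mtype_sound mt' _ _ _.
  exists B; first by apply/BsE; exists E, Q, Ds.
  apply: FFJ.T_Invk tyE tyCs (lastq_restrict refE vfs) mt' _.
  exact: subtypes_sound vfs (subs _ _ _ mt chCs).
- have [eqQn _] := lastq_inv CT_Object eqQ.
  have [l [l' [l_in fl' _ eql]]] := fields_sound fll vfs eqQn refC.
  exists C; first exact: mem_head.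
  apply: FFJ.T_New tyCs (lastq_restrict refC vfs) fl' _.
  (* A constructor call needs the exact field list, not just an inclusion; the absence of marks
     gives it. *)
  rewrite eql => [|fd]; last exact: nomark.
  exact: subtypes_sound vfs (subs _ _ l_in chCs).
- by exists C; [apply: mem_head|apply: typed_cast tyE].
Qed.

(** Class names enter terms only through [new] and casts, whose rules check them. *)
Lemma typed_validref G o t Es :
  PL.typed CT valid G o t Es ->
  PL.validref_classes CT valid [:: o] (term_classes t).
Proof.
have all_args ts (Tss : seq (seq cname)) :
    Forall2 (fun t _ => PL.validref_classes CT valid [:: o] (term_classes t)) ts Tss ->
    PL.validref_classes CT valid [:: o] (flatten (map term_classes ts)).
  elim=> [//|t0 Ts ts' Tss' ref0 _ IH] A /=.
  by rewrite mem_cat => /orP[/ref0|/IH].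
elim/PL_typed_ind => {t Es} //=
  [t0 Es m ts Tss Bs ref0 /all_args refs _ _ _|C ts Tss Q ll refC /all_args refs _ _ _ _
  |C t0 Es refC ref0] A.
- by rewrite mem_cat => /orP[/ref0|/refs].
- by rewrite inE => /predU1P[->|/refs].
- by rewrite inE => /predU1P[->|/ref0].
Qed.

(** * Well-formedness *)

(** Both tables continue at one position: [n] in the superclass for a class declaration, [Phi] in
    [C] for a refinement. *)
Lemma superq_sound Phi C Q :
  Phi \in fs -> superq CT Phi C = Some Q ->
  exists B k, Q = qtype_before CT B k /\
    superq CT' Phi C = Some (qtype_before CT' B k).
Proof.
move=> Phifs; case eqC: (CT Phi C) => [d|]; last by rewrite /superq eqC.
have := declE eqC; case: d eqC => [A D|A] fds ms eqC /= ?; subst A.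
  rewrite {1}/superq eqC => /(lastq_inv CT_Object)[-> _]; exists D, n; split=> //.
  by apply: superq_restrict_class Phifs _; exists fds, ms.
rewrite {1}/superq eqC => -[<-]; exists C, (Phi : nat); rewrite predqE ?eqC //.
split=> //; apply: superq_restrict_refines.
by rewrite /restrict Phifs eqC.
Qed.

Lemma introduce_field_sound W f C k :
  PL.variant valid W fs -> PL.validref_class CT valid W C ->
  PL.introduce_field CT valid W f (qtype_before CT C k) ->
  FFJ.introduce_field CT' f (qtype_before CT' C k).
Proof.
move=> vfs refC [ll fll notin].
have [l [l' [l_in fl' sub _]]] := fields_sound fll vfs erefl refC.
exists l' => //; apply: contra (notin l l_in) => /mapP[fd /sub fd_in ->].
exact: map_f.
Qed.

Lemma introduce_method_sound W m C k :
  PL.variant valid W fs ->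
  PL.introduce_method CT valid W m (qtype_before CT C k) ->
  FFJ.introduce_method CT' m (qtype_before CT' C k).
Proof.
by move=> vfs intro_m [s mt]; apply: intro_m; exists s; apply: mtype_sound mt _ _ _.
Qed.

(** The valid reference yields some derived signature; it occurs in the product line lookup, where
    all signatures equal [s]. *)
Lemma override_sound W m C k s :
  PL.variant valid W fs ->
  PL.override CT valid W m (qtype_before CT C k) s ->
  FFJ.override CT' m (qtype_before CT' C k) s.
Proof.
move=> vfs ov.
suff [s' mt] : exists s', FFJ.mtype CT' m (qtype_before CT' C k) s'.
  move: ov (mtype_sound vfs mt erefl).
  rewrite /FFJ.override; case: (qtype_before CT C k) => // Phi B.
  by case=> [Psis [Pis [_ _ eqs]]] /eqs <-.
move: ov; case: qtype_beforeP => // Phi PhiC ltk _ [Psis [Pis [eqRT intr _]]].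
apply: mtype_introduced_in (intr fs vfs) _ => Psi.
rewrite mem_rcons inE (RT_split eqRT) => /predU1P[-> //|/andP[lt _]].
exact: ltn_trans ltk.
Qed.

Lemma method_ok_sound Phi C M :
  Phi \in fs -> PL.method_ok CT valid Phi C M -> FFJ.method_ok CT' Phi C M.
Proof.
move=> Phifs [[Es ty subs] _ [Q eqQ ov]]; have vfs := variant1 valid_fs Phifs.
split.
  have [E0 E0_in ty0] := typed_sound ty vfs.
  by exists E0 => //; apply: subtype_sound (subs _ E0_in) vfs.
have [B [k [eqQB eqQ']]] := superq_sound Phifs eqQ.
rewrite {}eqQB in ov; exists (qtype_before CT' B k) => //.
by case: (m_overrides M) ov; [apply: override_sound|apply: introduce_method_sound].
Qed.

Lemma introduce_class_sound Phi C :
  Phi \in fs -> PL.introduce_class CT valid [:: Some Phi] Phi C ->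
  FFJ.introduce_class CT' Phi C.
Proof.
move=> Phifs uniqC [Psi [neq clPsi]]; apply: uniqC; exists Psi; split=> //.
  by move: clPsi; rewrite /class_decl /restrict; case: (Psi \in fs).
apply: sometimes_fs; first exact: variant1.
by move: clPsi; rewrite /class_decl /restrict; case: (Psi \in fs).
Qed.

(** [FFJ.refine] wants a class declaration at the head of the derived [RT C]. A refinement there
    would have a selected class declaration before it. *)
Lemma refine_sound Phi C fds ms :
  Phi \in fs -> CT Phi C = Some (Refines C fds ms) -> FFJ.refine CT' Phi C.
Proof.
move=> Phifs eqC.
have PhiC' : isSome (CT' Phi C) by rewrite /restrict Phifs eqC.
have refPhi : ~~ class_decl CT Phi C by rewrite /class_decl eqC.
have PhiC : isSome (CT Phi C) by rewrite eqC.
have [Psi [Psifs clPsi lt]] := class_before_refinement valid_fs Phifs PhiC refPhi.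
have PsiC' : isSome (CT' Psi C).
  by rewrite restrict_isSome Psifs class_decl_isSome.
case eqRT: _ / (splitPr (etrans (mem_RT CT' C Phi) PhiC')) => [Psis Omegas].
have := RT_split eqRT Psi; rewrite lt PsiC'.
case: Psis eqRT => [//|Psi1 Psis] eqRT _; exists Psi1, Psis, Omegas; split=> //.
have := RT_split eqRT Psi1; rewrite mem_head => /esym/andP[_ Psi1C'].
have := Psi1C'; rewrite restrict_isSome => /andP[Psi1fs Psi1C].
rewrite /class_decl /restrict Psi1fs -/(class_decl CT Psi1 C).
apply/negPn/negP => refPsi1.
have [Psi0 [Psi0fs clPsi0 lt0]] :=
  class_before_refinement valid_fs Psi1fs Psi1C refPsi1.
have Psi0C' : isSome (CT' Psi0 C).
  by rewrite restrict_isSome Psi0fs class_decl_isSome.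
(* Splitting at the head leaves an empty prefix, so no selected declaration precedes [Psi1]. *)
have := RT_split (Psis := [::]) eqRT Psi0.
by rewrite lt0 Psi0C'.
Qed.

Lemma decl_ok_sound Phi C d :
  CT' Phi C = Some d -> FFJ.decl_ok CT' Phi d.
Proof.
move=> /restrict_some[Phifs eqC]; have vfs := variant1 valid_fs Phifs.
have := declE eqC; have := decls_ok eqC.
case: d eqC => [A D|A] fds ms eqC /= ok ?; subst A.
  have [refD _ intrf uniqC oks] := ok; split.
  - move=> f /intrf[Q eqQ intr]; have [eqQn _] := lastq_inv CT_Object eqQ.
    rewrite {}eqQn in intr; exists (qtype_before CT' D n).
      exact: lastq_restrict refD vfs.
    exact: introduce_field_sound intr.
  - exact: introduce_class_sound.
  - by move=> M /oks; apply: method_ok_sound.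
have [_ intrf [Psis [Pis [eqRT refC]]] oks] := ok; split.
- have PhiC' : isSome (CT' Phi C) by rewrite /restrict Phifs eqC.
  move=> f /intrf; rewrite !predqE ?eqC //; apply: introduce_field_sound vfs _.
  case: refC => [CO|refC]; [by left|right=> gs /refC[Psi [Psigs ITPsi _]]].
  by exists Psi.
- exact: refine_sound eqC.
- by move=> M /oks; apply: method_ok_sound.
Qed.

(** * Sanity conditions and conclusion *)

Lemma decl_validref Phi C d A :
  CT Phi C = Some d -> A \in decl_classes d ->
  A = C \/ PL.validref_class CT valid [:: Some Phi] A.
Proof.
move=> eqC; have := declE eqC; have := decls_ok eqC.
have methods ms : (forall M, List.In M ms -> PL.method_ok CT valid Phi C M) ->
    A \in flatten (map method_classes ms) ->
    PL.validref_class CT valid [:: Some Phi] A.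
  elim: ms => [//|M ms IH] oks.
  rewrite -[flatten _]/(method_classes M ++ flatten (map method_classes ms)).
  rewrite mem_cat => /orP[|A_in]; last first.
    by apply: IH A_in => M' M'_in; apply: oks; right.
  have [[Es ty _] refs _] := oks M (or_introl erefl).
  rewrite /method_classes -cat_cons mem_cat => /orP[/refs //|].
  by have refBody := typed_validref ty; move=> /refBody.
case: d eqC => [B D|B] fds ms eqC /= ok ?; subst B; rewrite inE.
  have [refD refF _ _ oks] := ok => /predU1P[|/=]; first by left.
  rewrite inE mem_cat => /or3P[/eqP->|/refF|/(methods _ oks)]; by right.
have [refF _ _ oks] := ok => /predU1P[|/=]; first by left.
by rewrite mem_cat => /orP[/refF|/(methods _ oks)]; right.
Qed.

Lemma restrict_sane : table_sane CT'.
Proof.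
have [name_ok _ _ nodup] := CT_sane; split.
- by move=> Phi C d /restrict_some[_]; apply: name_ok.
- exact: restrict_Object.
(* A name in a selected declaration is its own name or a valid reference, so [fs] selects a
   declaration of it. *)
- move=> Phi C d A eqC A_in AO.
  have [Phifs eqC0] := (restrict_some _ _ _).1 eqC.
  have [->|refA] := decl_validref eqC0 A_in; first by exists Phi; rewrite eqC.
  have [Psi [Psifs clPsi]] := validref_class_fs refA (variant1 valid_fs Phifs) AO.
  by exists Psi; rewrite restrict_isSome Psifs class_decl_isSome.
- by move=> Phi C d /restrict_some[_]; apply: nodup.
Qed.

End Derive.

Theorem theorem3p1 (pl : PL.product_line) (fs : {set 'I_(PL.nfeat pl)}) :
  PL.well_typed pl -> PL.valid pl fs -> FFJ.well_typed (PL.derive pl fs).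
Proof.
case=> [[Cs ty] decls_ok sane acyc] valid_fs; split.
(* The main term lives in [Base], which every selection contains. *)
- have vfs : PL.variant (PL.valid pl) [:: None] fs by rewrite /PL.variant valid_fs.
  have [C _ tyC] := typed_sound valid_fs decls_ok sane ty vfs.
  by exists C.
- by move=> Phi C d; apply: (decl_ok_sound valid_fs decls_ok sane).
- exact: (restrict_sane valid_fs decls_ok sane).
- exact: acyc.
Qed.
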